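(* Let $\mathcal{B}_1(\ell_2)$ be the set of all bounded linear operators $T$ on the (real or complex) Hilbert space $\ell_2$ with $\|T\|\le 1$. For two topologies $\tau,\tau'$ on $\mathcal{B}_1(\ell_2)$, let $\mathcal{C}(\tau,\tau')$ denote the set of points of continuity of the identity map $(\mathcal{B}_1(\ell_2),\tau)\to(\mathcal{B}_1(\ell_2),\tau')$. Then: (1) $\mathcal{C}(\mathtt{WOT},\mathtt{SOT})$ is the set of all isometries. (2) $\mathcal{C}(\mathtt{WOT},\mathtt{SOT}^* )$ is the set of all unitary operators. (3) $\mathcal{C}(\mathtt{WOT},\mathtt{SOT}_* )$ is the set of all co-isometries. (4) $\mathcal{C}(\mathtt{SOT},\mathtt{SOT}^* )$ is the set of all co-isometries. (5) $\mathcal{C}(\mathtt{SOT}_*,\mathtt{SOT}^* )$ is the set of all isometries.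
   Context: Isometries are linear and not assumed surjective; a co-isometry is an operator $T$ such that $T^*$ is an isometry. For a net $(T_i)$ and $T$ of bounded operators on $X$ (here $X=\ell_2$): $T_i\to T$ in $\mathtt{SOT}$ iff $T_ix\to Tx$ in norm for all $x\in X$; in $\mathtt{WOT}$ iff $T_ix\to Tx$ weakly for all $x\in X$; in $\mathtt{SOT}_*$ iff $T_i^*\to T^*$ pointwise in norm; in $\mathtt{SOT}^*$ iff $T_i\to T$ in both $\mathtt{SOT}$ and $\mathtt{SOT}_*$. On $\mathcal{B}_1(\ell_2)$ one considers the induced topologies. *)

(* Defs.v *)
From HB Require Import structures.
From mathcomp Require Import all_boot all_order all_algebra.
From mathcomp Require Import complex ring lra.
From mathcomp Require Import all_classical all_reals all_analysis.

Set Implicit Arguments.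
Unset Strict Implicit.
Unset Printing Implicit Defensive.
Import Order.TTheory GRing.Theory Num.Theory.
Import numFieldNormedType.Exports.
Local Open Scope classical_set_scope.
Local Open Scope ring_scope.

(* Real and complex scalars are treated together; [scalars R k] is the scalar
   field of the Hilbert space. *)
Variant scalar_kind := RealScalars | ComplexScalars.

Definition scalars (R : realType) (k : scalar_kind) : numFieldType :=
  match k with
  | RealScalars => R
  | ComplexScalars => R[i]
  end.

Section Scalar.
Context (R : realType) (k : scalar_kind).
Local Notation K := (scalars R k).

Definition ofR : {rmorphism R -> K} :=
  match k return {rmorphism R -> scalars R k} with
  | RealScalars => idfun
  | ComplexScalars => real_complex R
  end.

Definition conjS : {rmorphism K -> K} :=
  match k return {rmorphism scalars R k -> scalars R k} with
  | RealScalars => idfun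
  | ComplexScalars => @conjc R
  end.

(* The library norm of a scalar is an element of the field itself; [modS] is
   the same number seen in [R] (see [ofR_modS]). *)
Definition modS : K -> R :=
  match k return scalars R k -> R with
  | RealScalars => fun a => `|a|
  | ComplexScalars => fun a => complex.Re `|a|
  end.

Lemma ofR_modS (a : K) : ofR (modS a) = `|a|.
Proof. by rewrite /ofR /modS; case: k a. Qed.

Lemma ler_ofR (x y : R) : (ofR x <= ofR y) = (x <= y).
Proof.
rewrite /ofR; case: k => //=.
by rewrite lecE /= eqxx.
Qed.

Lemma mulr_conjS (a : K) : a * conjS a = ofR (modS a ^+ 2).
Proof.
rewrite rmorphXn /= ofR_modS /conjS; case: k a => a.
  by rewrite /= -expr2 real_normK ?num_real.
by rewrite /= sqr_normc.
Qed.

Lemma conjSK : involutive conjS.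
Proof. by rewrite /conjS; case: k => a //=; rewrite conjcK. Qed.

End Scalar.

Section Ell2Space.
Context (R : realType) (k : scalar_kind).
Local Notation K := (scalars R k).
Implicit Types (a b : K) (x y : nat -> K).

Lemma modS_ge0 a : 0 <= modS a.
Proof. by rewrite -(ler_ofR k) rmorph0 ofR_modS. Qed.

Lemma modS0 : modS (0 : K) = 0.
Proof. by apply: (fmorph_inj (ofR R k)); rewrite ofR_modS normr0 rmorph0. Qed.

Lemma modS_eq0 a : modS a = 0 -> a = 0.
Proof. by move=> a0; apply/normr0_eq0; rewrite -ofR_modS a0 rmorph0. Qed.

Lemma modSM a b : modS (a * b) = modS a * modS b.
Proof.
by apply: (fmorph_inj (ofR R k)); rewrite rmorphM /= !ofR_modS normrM.
Qed.

Lemma modSD a b : modS (a + b) <= modS a + modS b.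
Proof. by rewrite -(ler_ofR k) rmorphD /= !ofR_modS ler_normD. Qed.

Definition summable2 : {pred nat -> K} :=
  mem [set x | cvgn (series (fun n => modS (x n) ^+ 2))].

Definition sqsum x : R := limn (series (fun n => modS (x n) ^+ 2)).

Lemma sq_ge0 x n : 0 <= modS (x n) ^+ 2.
Proof. by rewrite exprn_ge0 ?modS_ge0. Qed.

Lemma summable2_bounded x (M : R) :
  (forall n, \sum_(0 <= i < n) modS (x i) ^+ 2 <= M) ->
  x \in summable2 /\ sqsum x <= M.
Proof.
move=> xM.
have cx : cvgn (series (fun n => modS (x n) ^+ 2)).
  apply: nondecreasing_is_cvgn; first by apply: nondecreasing_series => n _ _; exact: sq_ge0.
  by exists M => _ [n _ <-]; exact: xM.
split; first exact: mem_set.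
by apply: limr_le => //; near=> n; exact: xM.
Unshelve. all: by end_near. Qed.

Lemma le_sqsum x n : x \in summable2 ->
  \sum_(0 <= i < n) modS (x i) ^+ 2 <= sqsum x.
Proof.
rewrite inE => cx; apply: (nondecreasing_cvgn_le _ cx).
by apply: nondecreasing_series => i _ _; exact: sq_ge0.
Qed.

Lemma sqsum_ge0 x : x \in summable2 -> 0 <= sqsum x.
Proof. by move=> /(le_sqsum 0); rewrite big_nil. Qed.

(* Minkowski, from (s + t)^2 <= (1 + c) s^2 + (1 + 1/c) t^2. *)
Lemma sqsumD x y : x \in summable2 -> y \in summable2 ->
  x + y \in summable2 /\
  Num.sqrt (sqsum (x + y)) <= Num.sqrt (sqsum x) + Num.sqrt (sqsum y).
Proof.
move=> cx cy.
have sc (c : R) : 0 < c -> x + y \in summable2 /\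
    sqsum (x + y) <= (1 + c) * sqsum x + (1 + c^-1) * sqsum y.
  move=> c0; apply: summable2_bounded => n.
  apply: (@le_trans _ _ ((1 + c) * \sum_(0 <= i < n) modS (x i) ^+ 2 +
                         (1 + c^-1) * \sum_(0 <= i < n) modS (y i) ^+ 2)).
    rewrite !mulr_sumr -big_split /=; apply: ler_sum => i _.
    apply: (@le_trans _ _ ((modS (x i) + modS (y i)) ^+ 2)).
      by rewrite lerXn2r ?nnegrE ?addr_ge0 ?modS_ge0 ?modSD.
    set s := modS (x i); set t := modS (y i).
    rewrite -subr_ge0.
    suff -> : (1 + c) * s ^+ 2 + (1 + c^-1) * t ^+ 2 - (s + t) ^+ 2
      = c^-1 * (c * s - t) ^+ 2.
      by rewrite mulr_ge0 ?sqr_ge0 ?invr_ge0 ?(ltW c0).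
    by field; rewrite gt_eqF.
  by rewrite lerD// ler_wpM2l ?le_sqsum// addr_ge0 ?invr_ge0 ?ltW.
split; first by case: (sc 1).
set s := Num.sqrt (sqsum x); set t := Num.sqrt (sqsum y).
have s0 : 0 <= s by rewrite sqrtr_ge0.
have t0 : 0 <= t by rewrite sqrtr_ge0.
have sE : sqsum x = s ^+ 2 by rewrite sqr_sqrtr ?sqsum_ge0.
have tE : sqsum y = t ^+ 2 by rewrite sqr_sqrtr ?sqsum_ge0.
apply/ler_addgt0Pr => e e0.
rewrite -(@ler_pXn2r _ 2) ?nnegrE ?sqrtr_ge0 ?addr_ge0 ?(ltW e0)//.
rewrite sqr_sqrtr ?sqsum_ge0 ?(sc 1 ltr01).1//.
have se : 0 < s + e / 2 by rewrite ltr_wpDl ?divr_gt0.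
have te : 0 < t + e / 2 by rewrite ltr_wpDl ?divr_gt0.
have [_ /le_trans] := sc ((t + e / 2) / (s + e / 2)) (divr_gt0 te se); apply.
rewrite sE tE.
apply: (@le_trans _ _ ((1 + (t + e / 2) / (s + e / 2)) * (s + e / 2) ^+ 2 +
  (1 + ((t + e / 2) / (s + e / 2))^-1) * (t + e / 2) ^+ 2)).
  have p0 := divr_gt0 te se.
  have sq_le (r : R) : 0 <= r -> r ^+ 2 <= (r + e / 2) ^+ 2.
    by move=> r0; rewrite lerXn2r ?nnegrE ?addr_ge0 ?lerDl ?divr_ge0 ?(ltW e0).
  by apply: lerD; apply: ler_wpM2l;
    rewrite ?sq_le// addr_ge0 ?invr_ge0 ?(ltW p0).
have -> : s + t + e = (s + e / 2) + (t + e / 2) by field.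
move: (s + e / 2) (t + e / 2) se te => S T S0 T0.
rewrite le_eqVlt; apply/orP; left; apply/eqP.
by field; rewrite !gt_eqF.
Qed.

Lemma sqsumZ a x : x \in summable2 -> a *: x \in summable2 /\
  sqsum (a *: x) = modS a ^+ 2 * sqsum x.
Proof.
rewrite inE /= => cx.
have E : (fun n => modS ((a *: x) n) ^+ 2) =
    modS a ^+ 2 *: (fun n => modS (x n) ^+ 2).
  apply/funext => n; rewrite -[RHS]/(modS a ^+ 2 * modS (x n) ^+ 2).
  by rewrite -exprMn -modSM.
split; first by rewrite inE /= E; exact: is_cvg_seriesZ.
by rewrite /sqsum E lim_seriesZ.
Qed.

Lemma summable2_submod : submod_closed summable2.
Proof.
split=> [|a x y cx cy]; last by case: (sqsumD (sqsumZ a cx).1 cy).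
by apply: (@summable2_bounded 0 0 _).1 => n; rewrite big1// => i _; rewrite modS0 expr0n.
Qed.

HB.instance Definition _ := GRing.isSubmodClosed.Build _ _ summable2
  summable2_submod.

Record ell2 : Type := Ell2 {
  ell2_seq :> nat -> K;
  _ : ell2_seq \in summable2 }.

HB.instance Definition _ := [isSub for ell2_seq].
HB.instance Definition _ := [Choice of ell2 by <:].
HB.instance Definition _ := [SubChoice_isSubLmodule of ell2 by <:].

Definition l2norm (u : ell2) : R := Num.sqrt (sqsum u).

Lemma l2norm_ge0 u : 0 <= l2norm u. Proof. exact: sqrtr_ge0. Qed.

Lemma sqr_l2norm (u : ell2) : l2norm u ^+ 2 = sqsum u.
Proof. by rewrite sqr_sqrtr// sqsum_ge0// (valP u). Qed.

Let ler_l2normD (u v : ell2) :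
  ofR R k (l2norm (u + v)) <= ofR R k (l2norm u) + ofR R k (l2norm v).
Proof. by rewrite -rmorphD ler_ofR; exact: (sqsumD (valP u) (valP v)).2. Qed.

Let l2normZ a (u : ell2) :
  ofR R k (l2norm (a *: u)) = `|a| * ofR R k (l2norm u).
Proof.
rewrite -ofR_modS -rmorphM; congr (ofR _ _ _).
rewrite /l2norm [X in sqsum X](_ : _ = a *: (u : nat -> K))//.
by rewrite (sqsumZ _ (valP u)).2 sqrtrM ?exprn_ge0 ?modS_ge0// sqrtr_sqr ger0_norm ?modS_ge0.
Qed.

Let l2norm_eq0 (u : ell2) : ofR R k (l2norm u) = 0 -> u = 0.
Proof.
move=> /eqP; rewrite fmorph_eq0 => /eqP u0; apply: val_inj; apply/funext => n /=.
apply: modS_eq0; apply/eqP; rewrite -sqrf_eq0 eq_le sq_ge0 andbT.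
have := le_sqsum n.+1 (valP u); rewrite -sqr_l2norm u0 expr0n /=.
apply: le_trans; rewrite big_nat_recr //= lerDr.
by apply: sumr_ge0 => i _; exact: sq_ge0.
Qed.

HB.instance Definition _ :=
  Lmodule_isNormed.Build K ell2 ler_l2normD l2normZ l2norm_eq0.

Lemma ell2_normE (u : ell2) : `|u| = ofR R k (l2norm u).
Proof. by []. Qed.

End Ell2Space.

Section InnerProduct.
Context (R : realType) (k : scalar_kind).
Local Notation K := (scalars R k).
Local Notation H := (ell2 R k).
Implicit Types (u v w : H) (a b : K).

Definition inner u v : K := limn (series (fun n => u n * conjS R k (v n))).

Let I : K :=
  match k return scalars R k with
  | RealScalars => 0
  | ComplexScalars => Complex 0 1
  end.

Let polar a b : a * conjS R k b =
  ofR R k ((modS (a + b) ^+ 2 - modS a ^+ 2 - modS b ^+ 2) / 2) +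
  I * ofR R k ((modS (a + I * b) ^+ 2 - modS a ^+ 2 - modS b ^+ 2) / 2).
Proof.
rewrite /I; case: k a b => a b.
  rewrite /= mul0r addr0 !real_normK ?num_real//.
  by field.
have ab (z : R[i]) : @modS R ComplexScalars z ^+ 2 = complex.Re z ^+ 2 + complex.Im z ^+ 2.
  by rewrite /modS normc_def /= sqr_sqrtr ?addr_ge0 ?sqr_ge0.
rewrite !ab; case: a b => [a1 a2] [b1 b2].
apply/eqP; rewrite eq_complex /=; apply/andP; split; apply/eqP; by field.
Qed.

Let cvg_ofR (f : nat -> R) (l : R) : f @ \oo --> l ->
  (ofR R k \o f) @ \oo --> ofR R k l.
Proof.
move=> /cvgrPdist_lt fl; apply/cvgrPdist_lt => e e0.
have eE : e = ofR R k (modS e) by rewrite ofR_modS gtr0_norm.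
have e0' : 0 < modS e by rewrite lt_def modS_ge0 andbT; apply: contraTneq e0 => e1; rewrite eE e1 rmorph0 ltxx.
near=> n; rewrite eE /= -rmorphB /= -ofR_modS.
have -> (r : R) : modS (ofR R k r) = `|r|.
  apply: (fmorph_inj (ofR R k)); rewrite ofR_modS.
  by rewrite /ofR; case: k => //=; rewrite normc_def /= expr0n addr0 sqrtr_sqr.
rewrite lt_neqAle ler_ofR (inj_eq (fmorph_inj _)) -lt_neqAle.
by near: n; exact: fl.
Unshelve. all: by end_near. Qed.

Lemma cvg_inner u v :
  series (fun n => u n * conjS R k (v n)) @ \oo --> inner u v.
Proof.
have cs (w : H) := valP w; have {}cs w : cvgn (series (fun n => modS (w n) ^+ 2)).
  by have := cs w; rewrite inE.
apply/cvg_ex.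
have P (w : H) : exists l : R, series (fun n => (modS (w n) ^+ 2 - modS (u n) ^+ 2 - modS (v n) ^+ 2) / 2) @ \oo --> l.
  apply/cvg_ex.
  have -> : (fun n => (modS (w n) ^+ 2 - modS (u n) ^+ 2 - modS (v n) ^+ 2) / 2) = 2^-1 *: ((fun n => modS (w n) ^+ 2) - (fun n => modS (u n) ^+ 2) - (fun n => modS (v n) ^+ 2)).
    by apply/funext => n; rewrite mulrC.
  by apply: is_cvg_seriesZ; do 2![apply: is_cvg_seriesB; last exact: cs]; exact: cs.
have [l1 cl1] := P (u + v); have [l2 cl2] := P (u + I *: v).
exists (ofR R k l1 + I * ofR R k l2).
have -> : series (fun n => u n * conjS R k (v n)) =
  (fun n => (ofR R k \o series (fun n => (modS ((u + v) n) ^+ 2 - modS (u n) ^+ 2 - modS (v n) ^+ 2) / 2)) n +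
  I * (ofR R k \o series (fun n => (modS ((u + I *: v) n) ^+ 2 - modS (u n) ^+ 2 - modS (v n) ^+ 2) / 2)) n).
  apply/funext => n; rewrite /series /= !rmorph_sum /= mulr_sumr -big_split /=.
  by apply: eq_bigr => i _; rewrite polar.
by apply: cvgD; [exact: cvg_ofR | apply: cvgM; [exact: cvg_cst | exact: cvg_ofR]].
Qed.

Lemma innerP u v l :
  series (fun n => u n * conjS R k (v n)) @ \oo --> l -> inner u v = l.
Proof. exact: cvg_lim. Qed.

Lemma innerDl u u' v : inner (u + u') v = inner u v + inner u' v.
Proof.
apply: innerP; rewrite [X in X @ _](_ : _ = (fun n =>
  series (fun n => u n * conjS R k (v n)) n + series (fun n => u' n * conjS R k (v n)) n)).
  by apply: cvgD; exact: cvg_inner.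
by apply/funext => n; rewrite /series /= -big_split; apply: eq_bigr => i _; exact: mulrDl.
Qed.

Lemma innerZl a u v : inner (a *: u) v = a * inner u v.
Proof.
apply: innerP; rewrite [X in X @ _](_ : _ = (fun n =>
  a * series (fun n => u n * conjS R k (v n)) n)).
  by apply: cvgM; [exact: cvg_cst|exact: cvg_inner].
by apply/funext => n; rewrite /series /= mulr_sumr; apply: eq_bigr => i _; exact/esym/mulrA.
Qed.

Lemma innerDr u v v' : inner u (v + v') = inner u v + inner u v'.
Proof.
apply: innerP; rewrite [X in X @ _](_ : _ = (fun n =>
  series (fun n => u n * conjS R k (v n)) n + series (fun n => u n * conjS R k (v' n)) n)).
  by apply: cvgD; exact: cvg_inner.
by apply/funext => n; rewrite /series /= -big_split; apply: eq_bigr => i _; rewrite /= -mulrDr -rmorphD.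
Qed.

Lemma innerZr a u v : inner u (a *: v) = conjS R k a * inner u v.
Proof.
apply: innerP; rewrite [X in X @ _](_ : _ = (fun n =>
  conjS R k a * series (fun n => u n * conjS R k (v n)) n)).
  by apply: cvgM; [exact: cvg_cst|exact: cvg_inner].
by apply/funext => n; rewrite /series /= mulr_sumr; apply: eq_bigr => i _; rewrite mulrCA -rmorphM.
Qed.

Lemma modSN a : modS (- a) = modS a.
Proof. by apply: (fmorph_inj (ofR R k)); rewrite !ofR_modS normrN. Qed.

Lemma modS_conj a : modS (conjS R k a) = modS a.
Proof.
by apply: (fmorph_inj (ofR R k)); rewrite !ofR_modS /conjS; case: k a => //= a; rewrite normcJ.
Qed.

Lemma lt_ofR (x y : R) : (ofR R k x < ofR R k y) = (x < y).
Proof. by rewrite !lt_neqAle ler_ofR (inj_eq (fmorph_inj _)). Qed.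

Lemma cvg_modS (f : nat -> K) (l : K) : f @ \oo --> l ->
  (fun n => modS (f n)) @ \oo --> modS l.
Proof.
move=> /cvgrPdist_lt fl; apply/cvgrPdist_lt => e e0.
have {}e0 : 0 < ofR R k e by rewrite -(rmorph0 (ofR R k)) lt_ofR.
near=> n.
apply: (@le_lt_trans _ _ (modS (l - f n))).
  rewrite ler_norml lerBlDr lerBrDl.
  apply/andP; split; last by rewrite -{1}(subrK (f n) l) modSD.
  rewrite -[modS (l - f n)]modSN opprB.
  by rewrite lerBlDr addrC -{1}(subrK l (f n)) modSD.
rewrite -(lt_ofR) ofR_modS.
by near: n; exact: fl.
Unshelve. all: by end_near. Qed.

Lemma inner_le u v : modS (inner u v) <= l2norm u * l2norm v.
Proof.
have [->|u0] := eqVneq u 0.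
  have -> : inner 0 v = 0 by rewrite -(scale0r (0 : H)) innerZl mul0r.
  by rewrite modS0 mulr_ge0 ?l2norm_ge0.
have [->|v0] := eqVneq v 0.
  have -> : inner u 0 = 0 by rewrite -(scale0r (0 : H)) innerZr rmorph0 mul0r.
  by rewrite modS0 mulr_ge0 ?l2norm_ge0.
have pos (w : H) : w != 0 -> 0 < l2norm w.
  move=> w0; rewrite lt_def l2norm_ge0 andbT; apply: contra w0 => /eqP w0.
  by rewrite -normr_eq0 ell2_normE w0 rmorph0.
have {}u0 := pos _ u0; have {}v0 := pos _ v0.
have c0 : 0 < l2norm v / l2norm u by rewrite divr_gt0.
set c := l2norm v / l2norm u in c0.
have cm : (fun n => modS (series (fun n => u n * conjS R k (v n)) n)) @ \oo -->
    modS (inner u v) by apply: cvg_modS; exact: cvg_inner.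
rewrite -(cvg_lim (@Rhausdorff R) cm).
apply: limr_le; first by apply/cvg_ex; eexists; exact: cm.
apply: nearW => n /=.
apply: (@le_trans _ _ (2^-1 * (c * \sum_(0 <= i < n) modS (u i) ^+ 2 +
  c^-1 * \sum_(0 <= i < n) modS (v i) ^+ 2))).
  rewrite !mulr_sumr -big_split /= mulr_sumr /series /=.
  elim/big_ind2: _ => [|x1 x2 y1 y2 xy1 xy2|i _]; first by rewrite modS0.
    by apply: le_trans (modSD _ _) _; exact: lerD.
  rewrite modSM modS_conj; move: (modS (u i)) (modS (v i)) => s t.
  rewrite -subr_ge0.
  have -> : 2^-1 * (c * s ^+ 2 + c^-1 * t ^+ 2) - s * t = 2^-1 * c^-1 * (c * s - t) ^+ 2.
    by field; rewrite gt_eqF.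
  by apply: mulr_ge0; rewrite ?sqr_ge0// mulr_ge0 ?invr_ge0 ?(ltW c0)//.
apply: (@le_trans _ _ (2^-1 * (c * l2norm u ^+ 2 + c^-1 * l2norm v ^+ 2))).
  rewrite ler_wpM2l ?invr_ge0// lerD// ler_wpM2l ?invr_ge0 ?(ltW c0)//
    sqr_l2norm le_sqsum//; exact: valP.
rewrite le_eqVlt; apply/orP; left; apply/eqP; rewrite /c.
by field; rewrite !gt_eqF.
Qed.
End InnerProduct.

Section Operators.
Context (R : realType) (k : scalar_kind).
Local Notation K := (scalars R k).
Local Notation H := (ell2 R k).

Record bop : Type := Bop {
  bop_lin :> {linear H -> H};
  bop_bounded : exists M : R, forall x : H, l2norm (bop_lin x) <= M * l2norm x }.

Definition opnorm (T : bop) : R :=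
  sup [set l2norm (T x) | x in [set x : H | l2norm x <= 1]].

Definition is_adjoint (T S : bop) : Prop :=
  forall x y : H, inner (T x) y = inner x (S y).

Let delta_summable (i : nat) : (fun n : nat => (n == i)%:R : K) \in @summable2 R k.
Proof.
apply: (@summable2_bounded _ _ _ 1 _).1 => n.
rewrite [leLHS](_ : _ = (i < n)%:R); first by case: ltnP.
elim: n => [|n IH]; first by rewrite big_nil ltn0.
rewrite big_nat_recr //= IH ltnS [n == i]eq_sym.
have mod1 : modS (1 : K) = 1.
  by apply: (fmorph_inj (ofR R k)); rewrite ofR_modS normr1 rmorph1.
by case: (ltngtP i n) => _; rewrite ?mod1 ?modS0 ?expr1n ?expr0n /= ?addr0 ?add0r.
Qed.

Let e i : H := Ell2 (delta_summable i).

Let tr (c : nat -> K) N : H := \sum_(i < N) c i *: e i.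

Let trE c N n : tr c N n = if (n < N)%N then c n else 0.
Proof.
rewrite /tr; elim: N => [|N IH]; first by rewrite big_ord0.
rewrite big_ord_recr /= -[LHS]/((\sum_(i < N) c i *: e i : H) n + c N * (n == N)%:R).
rewrite IH ltnS; case: (ltngtP n N) => [_|_|->]; rewrite ?mulr0 ?addr0//.
by rewrite mulr1 add0r.
Qed.

Let sum_tr c N n : \sum_(0 <= i < n) modS (tr c N i) ^+ 2 =
  \sum_(0 <= i < minn n N) modS (c i) ^+ 2.
Proof.
elim: n => [|n IH]; first by rewrite min0n !big_nil.
rewrite big_nat_recr //= IH trE; case: (ltnP n N) => nN.
  by rewrite (minn_idPl nN) big_nat_recr.
by rewrite (minn_idPr (leqW nN)) modS0 expr0n addr0.
Qed.

Let l2norm_le (x : H) (M : R) : 0 <= M ->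
  (forall n, \sum_(0 <= i < n) modS (x i) ^+ 2 <= M ^+ 2) -> l2norm x <= M.
Proof.
move=> M0 /summable2_bounded[_ xM].
by rewrite -(@ler_pXn2r _ 2) ?nnegrE ?l2norm_ge0// sqr_l2norm.
Qed.

Let le_sum_sq (x : nat -> K) m n : (m <= n)%N ->
  \sum_(0 <= i < m) modS (x i) ^+ 2 <= \sum_(0 <= i < n) modS (x i) ^+ 2.
Proof.
move=> mn; rewrite (big_cat_nat _ mn)//= lerDl.
by apply: sumr_ge0 => i _; exact: sq_ge0.
Qed.

Let tr_norm c N : l2norm (tr c N) <= Num.sqrt (\sum_(0 <= i < N) modS (c i) ^+ 2).
Proof.
apply: l2norm_le => [|n]; first exact: sqrtr_ge0.
rewrite sqr_sqrtr; last by apply: sumr_ge0 => i _; exact: sq_ge0.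
by rewrite sum_tr; apply: le_sum_sq; exact: geq_minr.
Qed.

Let tr_cvg (x : H) : (fun N => l2norm (x - tr x N)) @ \oo --> (0 : R).
Proof.
have cx : cvgn (series (fun n => modS (x n) ^+ 2)) by have := valP x; rewrite inE.
have bnd N : l2norm (x - tr x N) <=
    Num.sqrt (sqsum x - series (fun n => modS (x n) ^+ 2) N).
  apply: l2norm_le => [|n]; first exact: sqrtr_ge0.
  rewrite sqr_sqrtr; last by rewrite subr_ge0 le_sqsum// (valP x).
  apply: (le_trans (le_sum_sq _ (leq_maxl n N))).
  have := le_sqsum (maxn n N) (valP x).
  rewrite lerBrDr; apply: le_trans.
  have -> : series (fun n => modS (x n) ^+ 2) N =
      \sum_(0 <= i < maxn n N) modS (tr x N i) ^+ 2.
    by rewrite sum_tr (minn_idPr (leq_maxr n N)).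
  rewrite -big_split /=.
  apply: ler_sum => i _; rewrite -[X in modS X ^+ 2 + _]/(x i - tr x N i) trE.
  by case: ifP => _; rewrite ?subrr ?subr0 modS0 expr0n ?addr0 ?add0r.
apply: (@squeeze_cvgr _ _ _ _ (fun=> 0)
  (fun N => Num.sqrt (sqsum x - series (fun n => modS (x n) ^+ 2) N))).
- by apply: nearW => N; rewrite l2norm_ge0 bnd.
- exact: cvg_cst.
rewrite -(sqrtr0 R); apply: (@continuous_cvg _ _ _ _ _ _ (@Num.sqrt R)).
  exact: sqrt_continuous.
rewrite -(subrr (sqsum x)); apply: cvgB; first exact: cvg_cst.
exact: cx.
Qed.

Let inner_tr (T : bop) c N y : inner (T (tr c N)) y =
  \sum_(0 <= i < N) c i * inner (T (e i)) y.
Proof.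
rewrite /tr; elim: N => [|N IH].
  rewrite big_ord0 big_nil linear0 -(scale0r (0 : H)) innerZl mul0r//.
rewrite big_ord_recr big_nat_recr //= linearD linearZ innerDl innerZl.
by rewrite IH.
Qed.

Lemma adjoint_exists (T : bop) : exists S, is_adjoint T S.
Proof.
have [M0 TM0] := bop_bounded T.
have [M [M_ge0 TM]] : exists M, 0 <= M /\ forall x, l2norm (T x) <= M * l2norm x.
  exists `|M0|; split=> // x; apply: (le_trans (TM0 x)).
  by rewrite ler_wpM2r ?l2norm_ge0// ler_norm.
pose z (y : H) (n : nat) : K := conjS R k (inner (T (e n)) y).
have zb y n : \sum_(0 <= i < n) modS (z y i) ^+ 2 <= (M * l2norm y) ^+ 2.
  set A := \sum_(0 <= i < n) _.
  have A0 : 0 <= A by apply: sumr_ge0 => i _; exact: sq_ge0.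
  have AE : ofR R k A = inner (T (tr (z y) n)) y.
    rewrite inner_tr rmorph_sum; apply: eq_bigr => i _.
    by rewrite -mulr_conjS {2}/z conjSK.
  have B0 : 0 <= M * l2norm y by rewrite mulr_ge0// l2norm_ge0.
  have : A <= (M * l2norm y) * Num.sqrt A.
    have -> : A = modS (inner (T (tr (z y) n)) y).
      apply: (fmorph_inj (ofR R k)); rewrite ofR_modS -AE ger0_norm//.
      by rewrite -(rmorph0 (ofR R k)) ler_ofR.
    apply: (le_trans (inner_le _ _)).
    rewrite mulrAC ler_wpM2r ?l2norm_ge0//; apply: (le_trans (TM _)).
    rewrite ler_wpM2l// (le_trans (tr_norm _ _))//.
    rewrite (_ : modS _ = A)//.
    apply: (fmorph_inj (ofR R k)); rewrite ofR_modS -AE ger0_norm//.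
    by rewrite -(rmorph0 (ofR R k)) ler_ofR.
  rewrite -{1 3}(sqr_sqrtr A0); move: (Num.sqrt A) (sqrtr_ge0 A) => s.
  rewrite le_eqVlt => /predU1P[<- _|s0]; first by rewrite expr0n sqr_ge0.
  by rewrite expr2 ler_pM2r// => sB; rewrite -expr2 lerXn2r ?nnegrE ?(ltW s0).
have zin y : z y \in @summable2 R k by exact: (summable2_bounded (zb y)).1.
pose S y : H := Ell2 (zin y).
have Slin : linear S.
  move=> a u v; apply: val_inj; apply/funext => n.
  rewrite -[RHS]/(a * z u n + z v n) /= /z innerDr innerZr rmorphD rmorphM.
  by rewrite conjSK.
have Sb : exists M : R, forall x : H, l2norm (S x) <= M * l2norm x.
  by exists M => y; apply: l2norm_le; [rewrite mulr_ge0 ?l2norm_ge0|exact: zb].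
pose SL : {linear H -> H} := HB.pack S (GRing.isLinear.Build _ _ _ _ S Slin).
exists (@Bop SL Sb) => x y /=.
apply/esym/innerP.
have E : series (fun n => x n * conjS R k (S y n)) = (fun N => inner (T (tr x N)) y).
  apply/funext => N; rewrite inner_tr; apply: eq_bigr => i _.
  by rewrite /= /z conjSK.
rewrite E.
have cM : (fun N => M * l2norm (x - tr x N) * l2norm y) @ \oo --> (0 : R).
  rewrite -(mul0r (l2norm y)) -(mulr0 M).
  by apply: cvgM; [apply: cvgM; [exact: cvg_cst|exact: tr_cvg]|exact: cvg_cst].
apply/cvgrPdist_lt => eps eps0.
have epsE : eps = ofR R k (modS eps) by rewrite ofR_modS gtr0_norm.
have {}eps0 : 0 < modS eps by rewrite -(lt_ofR k) rmorph0 -epsE.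
near=> N.
rewrite epsE -ofR_modS lt_ofR.
have -> : inner (T x) y - inner (T (tr x N)) y = inner (T (x - tr x N)) y.
  by rewrite linearB -[- T (tr x N)]scaleN1r innerDl innerZl mulN1r.
apply: (le_lt_trans (inner_le _ _)).
apply: (@le_lt_trans _ _ (M * l2norm (x - tr x N) * l2norm y)).
  by rewrite ler_wpM2r ?l2norm_ge0.
near: N; exact: (cvgr_lt _ cM).
Unshelve. all: by end_near. Qed.
End Operators.

Definition adjoint (R : realType) (k : scalar_kind) (T : bop R k) : bop R k :=
  projT1 (cid (adjoint_exists T)).

Lemma adjointP (R : realType) (k : scalar_kind) (T : bop R k) :
  is_adjoint T (adjoint T).
Proof. exact: projT2 (cid (adjoint_exists T)). Qed.

Record ball1 (R : realType) (k : scalar_kind) : Type := Ball1 {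
  ball1_op :> bop R k;
  ball1_opnorm : opnorm ball1_op <= 1 }.

HB.instance Definition _ R k := gen_eqMixin (ball1 R k).
HB.instance Definition _ R k := gen_choiceMixin (ball1 R k).

Record cdual (R : realType) (k : scalar_kind) : Type := CDual {
  cdual_form :> {scalar ell2 R k};
  cdual_continuous : continuous cdual_form }.

Lemma cvg_initial (S : choiceType) (T : topologicalType) (f : S -> T)
    (F : set_system S) (s : S) : Filter F ->
  F --> (s : initial_topology f) <-> f x @[x --> F] --> f s.
Proof.
move=> FF; split=> [Fs|fFs].
  exact: (cvg_comp _ _ Fs (@initial_continuous _ _ f s)).
move=> A [B [[W oW <-]] Wfs] /filterS; apply.
by apply: fFs; exact: open_nbhs_nbhs.
Qed.

Lemma cvg_ptws (U : Type) (V : topologicalType) (F : set_system (U -> V))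
    (g : U -> V) : Filter F ->
  F --> (g : {ptws U -> V}) <-> forall x, h x @[h --> F] --> g x.
Proof.
move=> FF; split=> [/cvg_sup Fg x|Fg]; first by move: (Fg x) => /cvg_initial.
by apply/cvg_sup => x; apply/cvg_initial; exact: Fg.
Qed.

Section Topologies.
Context (R : realType) (k : scalar_kind).
Local Notation K := (scalars R k).
Local Notation H := (ell2 R k).
Local Notation B1 := (ball1 R k).

Definition weak_ell2 : topologicalType :=
  initial_topology (fun (x : H) => (fun phi => phi x) : {ptws cdual R k -> K}).

Definition SOT : topologicalType :=
  initial_topology (fun (T : B1) => (fun x => T x) : {ptws H -> H}).

Definition WOT : topologicalType :=
  initial_topology (fun (T : B1) => (fun x => T x) : {ptws H -> weak_ell2}).

(* [SOTl] is the topology written SOT with a lower star, [SOTu] the one with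
   an upper star. *)
Definition SOTl : topologicalType :=
  initial_topology (fun (T : B1) => (fun x => adjoint T x) : {ptws H -> H}).

Definition SOTu : topologicalType :=
  initial_topology (fun (T : B1) =>
    ((fun x => T x) : {ptws H -> H}, (fun x => adjoint T x) : {ptws H -> H})).

Lemma cvg_weakP (F : set_system H) (x : H) : Filter F ->
  F --> (x : weak_ell2) <-> forall phi : cdual R k, phi y @[y --> F] --> phi x.
Proof.
move=> FF; split=> [/cvg_initial/cvg_ptws //|xF].
by apply/cvg_initial/cvg_ptws.
Qed.

Lemma cvg_SOTP (F : set_system B1) (T : B1) : Filter F ->
  F --> (T : SOT) <-> forall x : H, S x @[S --> F] --> T x.
Proof.
move=> FF; split=> [/cvg_initial/cvg_ptws //|TF].
by apply/cvg_initial/cvg_ptws.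
Qed.

Lemma cvg_WOTP (F : set_system B1) (T : B1) : Filter F ->
  F --> (T : WOT) <->
  forall (x : H) (phi : cdual R k), phi (S x) @[S --> F] --> phi (T x).
Proof.
move=> FF; split=> [/cvg_initial/cvg_ptws TF x|TF].
  exact: ((cvg_weakP _ _).1 (TF x)).
by apply/cvg_initial/cvg_ptws => x; apply: (cvg_weakP _ _).2; exact: TF.
Qed.

Lemma cvg_SOTlP (F : set_system B1) (T : B1) : Filter F ->
  F --> (T : SOTl) <-> forall x : H, adjoint S x @[S --> F] --> adjoint T x.
Proof.
move=> FF; split=> [/cvg_initial/cvg_ptws //|TF].
by apply/cvg_initial/cvg_ptws.
Qed.

Lemma cvg_SOTuP (F : set_system B1) (T : B1) : Filter F ->
  F --> (T : SOTu) <-> F --> (T : SOT) /\ F --> (T : SOTl).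
Proof.
move=> FF; split=> [/cvg_initial TF|[/cvg_initial T1 /cvg_initial T2]].
  split; apply/cvg_initial.
    exact: (cvg_comp _ _ TF cvg_fst).
  exact: (cvg_comp _ _ TF cvg_snd).
apply/cvg_initial => A [[P Q] [/= /T1 FP /T2 FQ] PQA].
by apply: (@filterS _ F FF _ _ _ (@filterI _ F FF _ _ FP FQ)) => S [SP SQ]; exact: PQA.
Qed.

Definition isometry_op (T : bop R k) : Prop := forall x : H, `|T x| = `|x|.

Definition coisometry_op (T : bop R k) : Prop := isometry_op (adjoint T).

Definition unitary_op (T : bop R k) : Prop :=
  (forall x : H, adjoint T (T x) = x) /\ (forall x : H, T (adjoint T x) = x).

End Topologies.

(* [continuity_points tau tau'] is the set C(tau, tau'); all the topologies
   above have [ball1 R k] as underlying type. *)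
Definition continuity_points (S S' : topologicalType) (f : S -> S') : set S :=
  [set x | {for x, continuous f}].

(* Main.v *)
Require Import Defs.
From HB Require Import structures.
From mathcomp Require Import all_boot all_order all_algebra.
From mathcomp Require Import ring lra.
From mathcomp Require Import all_classical all_reals all_analysis.
Local Open Scope classical_set_scope.

Set Implicit Arguments.
Unset Strict Implicit.
Unset Printing Implicit Defensive.
Import Order.TTheory GRing.Theory Num.Theory.
Import numFieldNormedType.Exports.

(** Why the continuity points are what they are.

    If [T] is an isometry and [S] is a contraction, expanding the square of
    [S x = T x + (S x - T x)] gives
    [|S x - T x|^2 <= |S x|^2 - |T x|^2 + 2 |<S x - T x, T x>|], and
    [|S x| <= |x| = |T x|].  Hence weak convergence of [S x] to [T x] already
    forces norm convergence ([isometry_cvg_WOT_SOT]).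

    Conversely, let [T] be a contraction, [x] a vector of norm at most 1 and
    [u = x - T^* T x].  Replacing the [n]-th coordinate of [T y] by [<y, u>]
    yields operators [S_n], which are again contractions: the form
    [<y, x> - <T y, T x>] is positive, so Cauchy-Schwarz gives
    [|<y, u>|^2 <= |y|^2 - |T y|^2], which is exactly the room that [T] leaves
    ([defect_cauchy_schwarz]).  Since [S_n] differs from [T] by a rank one
    operator with range spanned by the basis vector [e_n], and the coordinates
    of any [w] in [ell2] tend to 0, the adjoints of the [S_n] converge to [T^*] pointwise in norm.  However
    [S_n x - T x] is a multiple of [e_n] whose norm tends to
    [<x, u> = |x|^2 - |T x|^2].  So if convergence in the lower-star topology
    forces strong convergence at [T], then [T] is an isometry
    ([isometry_of_cvg_SOTl_SOT]).  The same sequence serves the weak topology,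
    which is coarser than both others.

    Taking adjoints preserves the weak operator topology and exchanges the
    strong one with the lower-star one, so the statements on co-isometries are
    those on isometries read through the adjoint.  The unitary operators are the
    isometries that are co-isometries ([unitaryP]). *)

(** * The inner product and the norm of [ell2] *)

Section InnerProductAndNorm.
Local Open Scope ring_scope.
Context (R : realType) (k : scalar_kind).
Local Notation K := (scalars R k).
Local Notation H := (ell2 R k).
Local Notation ofR := (ofR R k).
Local Notation conjS := (conjS R k).
Implicit Types (a b : K) (u v w : H).

Lemma ofR_inj : injective ofR.
Proof. exact: fmorph_inj. Qed.

Lemma modS_ofR (r : R) : modS (ofR r) = `|r|.
Proof.
have mp (s : R) : 0 <= s -> modS (ofR s) = s.
  move=> s0; apply: ofR_inj; rewrite ofR_modS ger0_norm//.
  by rewrite -(rmorph0 ofR) ler_ofR.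
have [r0|r0] := leP 0 r; first by rewrite mp// ger0_norm.
by rewrite -modSN -rmorphN mp ?ltr0_norm// oppr_ge0 ltW.
Qed.

Lemma innerNl u v : inner (- u) v = - inner u v.
Proof. by rewrite -scaleN1r innerZl mulN1r. Qed.

Lemma innerNr u v : inner u (- v) = - inner u v.
Proof. by rewrite -scaleN1r innerZr rmorphN rmorph1 mulN1r. Qed.

Lemma innerBl u u' v : inner (u - u') v = inner u v - inner u' v.
Proof. by rewrite innerDl innerNl. Qed.

Lemma innerBr u v v' : inner u (v - v') = inner u v - inner u v'.
Proof. by rewrite innerDr innerNr. Qed.

Lemma inner_conj u v : inner v u = conjS (inner u v).
Proof.
apply: innerP.
rewrite [X in X @ _](_ : _ =
  (fun n => conjS (series (fun n => u n * conjS (v n)) n))); last first.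
  apply/funext => n; rewrite /series /= rmorph_sum; apply: eq_bigr => i _.
  by rewrite rmorphM conjSK mulrC.
apply/cvgrPdist_lt => e e0; near=> n.
rewrite -rmorphB -ofR_modS modS_conj ofR_modS.
near: n; move: e e0; apply/cvgrPdist_lt; exact: cvg_inner.
Unshelve. all: by end_near. Qed.

Lemma modS_innerC u v : modS (inner v u) = modS (inner u v).
Proof. by rewrite inner_conj modS_conj. Qed.

Lemma inner_norm u : inner u u = ofR (l2norm u ^+ 2).
Proof.
rewrite sqr_l2norm; apply: innerP.
have cu : series (fun n => modS (u n) ^+ 2) @ \oo --> sqsum u.
  by have := valP u; rewrite inE.
rewrite [X in X @ _](_ : _ =
  (fun n => ofR (series (fun n => modS (u n) ^+ 2) n))); last first.
  apply/funext => n; rewrite /series /= rmorph_sum; apply: eq_bigr => i _.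
  by rewrite mulr_conjS.
apply/cvgrPdist_lt => e e0.
have eE : e = ofR (modS e) by rewrite ofR_modS gtr0_norm.
have e1 : 0 < modS e by rewrite -(lt_ofR k) rmorph0 -eE.
near=> n; rewrite -rmorphB -ofR_modS modS_ofR eE lt_ofR.
near: n; move: (modS e) e1; exact/cvgrPdist_lt.
Unshelve. all: by end_near. Qed.

Lemma modS_inner u : modS (inner u u) = l2norm u ^+ 2.
Proof. by rewrite inner_norm modS_ofR ger0_norm// exprn_ge0// l2norm_ge0. Qed.

Lemma l2norm0 : l2norm (0 : H) = 0.
Proof. by apply: ofR_inj; rewrite -ell2_normE normr0 rmorph0. Qed.

Lemma l2norm_eq0 u : l2norm u = 0 -> u = 0.
Proof. by move=> u0; apply/normr0_eq0; rewrite ell2_normE u0 rmorph0. Qed.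

Lemma l2normD u v : l2norm (u + v) <= l2norm u + l2norm v.
Proof. by rewrite -(ler_ofR k) rmorphD /= -!ell2_normE ler_normD. Qed.

Lemma l2normN u : l2norm (- u) = l2norm u.
Proof. by apply: ofR_inj; rewrite -!ell2_normE normrN. Qed.

Lemma l2normB u v : l2norm (u - v) = l2norm (v - u).
Proof. by rewrite -l2normN opprB. Qed.

Lemma l2normZ a u : l2norm (a *: u) = modS a * l2norm u.
Proof.
by apply: ofR_inj; rewrite rmorphM /= -!ell2_normE ofR_modS normrZ.
Qed.

(** Expanding the square of [v + d]; bounding the cross terms by the modulus of
    one of them avoids real parts. *)
Lemma l2norm_sqr_increment v d :
  l2norm d ^+ 2 <= l2norm (v + d) ^+ 2 - l2norm v ^+ 2 + 2 * modS (inner d v).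
Proof.
have E : inner d v + inner v d =
    ofR (l2norm (v + d) ^+ 2 - l2norm v ^+ 2 - l2norm d ^+ 2).
  rewrite !rmorphB /= -!inner_norm innerDl !innerDr; ring.
have := modSD (inner d v) (inner v d).
rewrite E modS_ofR (modS_innerC d v).
move: (l2norm (v + d) ^+ 2) (l2norm v ^+ 2) (l2norm d ^+ 2) => x y z.
by rewrite ler_norml => /andP[]; lra.
Qed.

Lemma pythagoras u v : inner u v = 0 ->
  l2norm (u + v) ^+ 2 = l2norm u ^+ 2 + l2norm v ^+ 2.
Proof.
move=> uv; apply: ofR_inj; rewrite rmorphD /= -!inner_norm.
by rewrite innerDl !innerDr uv (inner_conj u v) uv rmorph0 addr0 add0r.
Qed.

Lemma modS1 : modS (1 : K) = 1.
Proof. by apply: ofR_inj; rewrite ofR_modS normr1 rmorph1. Qed.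

Lemma unit_seq_summable2 (n : nat) :
  (fun m : nat => (m == n)%:R : K) \in @summable2 R k.
Proof.
apply: (@summable2_bounded _ _ _ 1 _).1 => N.
apply: (@le_trans _ _ (\sum_(0 <= i < N | i == n) 1)).
  rewrite [leRHS]big_mkcond; apply: ler_sum => i _.
  by case: eqP; rewrite ?modS1 ?modS0 ?expr1n ?expr0n.
rewrite big_const_seq iter_addr addr0 -[leRHS]mulr1n ler_nat.
by rewrite (count_uniq_mem _ (iota_uniq _ _)) leq_b1.
Qed.

Definition unit_vec n : H := Ell2 (unit_seq_summable2 n).

Lemma inner_unit_vec u n : inner u (unit_vec n) = u n.
Proof.
apply: innerP; apply/cvgrPdist_lt => e e0; near=> N.
suff -> : series (fun i => u i * conjS (unit_vec n i)) N = u n.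
  by rewrite subrr normr0.
have nN : (n < N)%N by near: N; exact: nbhs_infty_gt.
rewrite /series /= (bigD1_seq n) ?mem_index_iota ?iota_uniq//=.
rewrite eqxx rmorph1 mulr1 big1 ?addr0// => i /negbTE ->.
by rewrite rmorph0 mulr0.
Unshelve. all: by end_near. Qed.

Lemma l2norm_unit_vec n : l2norm (unit_vec n) = 1.
Proof.
have : l2norm (unit_vec n) ^+ 2 = 1.
  by rewrite -modS_inner inner_unit_vec /= eqxx modS1.
move/eqP; rewrite sqrf_eq1 => /orP[/eqP//|/eqP e1].
by have := l2norm_ge0 (unit_vec n); rewrite e1 oppr_ge0 ler10.
Qed.

Lemma coordinate_cvg0 u (e : R) : 0 < e -> \forall n \near \oo, modS (u n) < e.
Proof.
move=> e0.
have /cvg_series_cvg_0/cvgr0Pnorm_lt/(_ (e ^+ 2) (exprn_gt0 2 e0)) :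
    cvgn (series (fun n => modS (u n) ^+ 2)) by have := valP u; rewrite inE.
apply: filterS => n; rewrite ger0_norm ?sq_ge0//.
by rewrite ltr_pXn2r// nnegrE ?modS_ge0// ltW.
Qed.

Lemma cvg_ell2P (T : Type) (F : set_system T) (f : T -> H) v : Filter F ->
  f @ F --> v <-> forall e : R, 0 < e -> \forall t \near F, l2norm (f t - v) < e.
Proof.
move=> FF; split=> [/cvgrPdist_lt fv e e0|fv].
  have e1 : 0 < ofR e by rewrite -(rmorph0 ofR) lt_ofR.
  by near do rewrite l2normB -(lt_ofR k) -ell2_normE; exact: fv.
apply/cvgrPdist_lt => e e0.
have eE : e = ofR (modS e) by rewrite ofR_modS gtr0_norm.
have e1 : 0 < modS e by rewrite -(lt_ofR k) rmorph0 -eE.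
near do rewrite ell2_normE l2normB eE lt_ofR; exact: fv.
Unshelve. all: by end_near. Qed.

Lemma cvg_scalarsP (T : Type) (F : set_system T) (f : T -> K) a : Filter F ->
  f @ F --> a <-> forall e : R, 0 < e -> \forall t \near F, modS (f t - a) < e.
Proof.
move=> FF; split=> [/cvgrPdist_lt fv e e0|fv].
  have e1 : 0 < ofR e by rewrite -(rmorph0 ofR) lt_ofR.
  by near do rewrite -modSN opprB -(lt_ofR k) ofR_modS; exact: fv.
apply/cvgrPdist_lt => e e0.
have eE : e = ofR (modS e) by rewrite ofR_modS gtr0_norm.
have e1 : 0 < modS e by rewrite -(lt_ofR k) rmorph0 -eE.
near do rewrite -ofR_modS -modSN opprB eE lt_ofR; exact: fv.
Unshelve. all: by end_near. Qed.

End InnerProductAndNorm.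

(** * Contractions and adjoints *)

Section Operators.
Local Open Scope ring_scope.
Context (R : realType) (k : scalar_kind).
Local Notation K := (scalars R k).
Local Notation H := (ell2 R k).
Local Notation ofR := (ofR R k).
Local Notation conjS := (conjS R k).
Implicit Types (T : bop R k) (u v w x y : H).

Lemma opnorm_le1P T : opnorm T <= 1 <-> forall x, l2norm (T x) <= l2norm x.
Proof.
have [M TM] := bop_bounded T.
have ubT : has_ubound [set l2norm (T x) | x in [set x : H | l2norm x <= 1]].
  exists `|M| => _ [x x1 <-]; apply: (le_trans (TM x)).
  apply: (@le_trans _ _ (`|M| * l2norm x)).
    by rewrite ler_wpM2r ?l2norm_ge0// ler_norm.
  by rewrite -[leRHS]mulr1 ler_wpM2l.
split=> [T1 x|T1].
  have [->|x0] := eqVneq x 0; first by rewrite linear0.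
  have xp : 0 < l2norm x.
    by rewrite lt_def l2norm_ge0 andbT; apply: contra x0 => /eqP/l2norm_eq0 ->.
  have mx : modS (ofR (l2norm x)^-1) = (l2norm x)^-1.
    by rewrite modS_ofR ger0_norm// invr_ge0 ltW.
  have := le_trans (ub_le_sup ubT _) T1.
  move=> /(_ (l2norm (T (ofR (l2norm x)^-1 *: x)))).
  rewrite linearZ l2normZ mx ler_pdivrMl ?mulr1//; apply.
  exists (ofR (l2norm x)^-1 *: x); last by rewrite linearZ l2normZ mx.
  by rewrite /= l2normZ mx mulVf// gt_eqF.
apply: ge_sup; first by exists (l2norm (T 0)), 0 => //=; rewrite l2norm0.
by move=> _ [x x1 <-]; exact: le_trans (T1 x) x1.
Qed.

Lemma ball1_contraction (T : ball1 R k) x : l2norm (T x) <= l2norm x.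
Proof. exact: (opnorm_le1P T).1 (ball1_opnorm T) x. Qed.

Lemma bop_of_linear (f : H -> H) : linear f ->
  (exists M : R, forall x, l2norm (f x) <= M * l2norm x) ->
  exists T, forall x, T x = f x.
Proof.
move=> fl fM.
pose L : {linear H -> H} := HB.pack f (GRing.isLinear.Build _ _ _ _ f fl).
by exists (@Bop _ _ L fM).
Qed.

Lemma ball1_of_linear (f : H -> H) : linear f ->
  (forall x, l2norm (f x) <= l2norm x) ->
  exists T : ball1 R k, forall x, T x = f x.
Proof.
move=> fl f1; have [|T TE] := bop_of_linear fl.
  by exists 1 => x; rewrite mul1r.
have T1 : opnorm T <= 1 by apply/opnorm_le1P => x; rewrite TE.
by exists (Ball1 T1).
Qed.

Lemma inner_adjoint T x y : inner (T x) y = inner x (adjoint T y).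
Proof. exact: adjointP. Qed.

Lemma inner_adjointl T x y : inner (adjoint T x) y = inner x (T y).
Proof. by rewrite inner_conj -inner_adjoint -inner_conj. Qed.

Lemma inner_ext u v : (forall w, inner u w = inner v w) -> u = v.
Proof.
move=> uv; apply/eqP; rewrite -subr_eq0; apply/eqP/l2norm_eq0/eqP.
by rewrite -sqrf_eq0 -modS_inner innerBl uv subrr modS0.
Qed.

Lemma adjointK T x : adjoint (adjoint T) x = T x.
Proof. by apply: inner_ext => w; rewrite inner_adjointl -inner_adjoint. Qed.

Lemma adjoint_opnorm (T : ball1 R k) : opnorm (adjoint T) <= 1.
Proof.
apply/opnorm_le1P => x; have [->|x0] := eqVneq (l2norm (adjoint T x)) 0.
  exact: l2norm_ge0.
have xp : 0 < l2norm (adjoint T x) by rewrite lt_def x0 l2norm_ge0.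
rewrite -(ler_pM2l xp) -expr2 -modS_inner -inner_adjoint.
apply: (le_trans (inner_le _ _)).
by rewrite ler_wpM2r ?l2norm_ge0 ?ball1_contraction.
Qed.

Definition ball1_adjoint (T : ball1 R k) : ball1 R k := Ball1 (adjoint_opnorm T).

(** The operator sending [y] to [phi y] times a fixed unit vector has an
    adjoint, and the image of that unit vector under it represents [phi]. *)
Lemma riesz_representation (phi : cdual R k) :
  exists w, forall y, phi y = inner y w.
Proof.
have [M phiM] : exists M : R, forall y, modS (phi y) <= M * l2norm y.
  have /nbhs_ballP[d /= d0 phid] : \forall y \near (0 : H), modS (phi y) < 1.
    have := @cdual_continuous _ _ phi 0.
    rewrite /continuous_at linear0 => /cvg_scalarsP/(_ 1 ltr01).
    by apply: filterS => y; rewrite subr0.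
  have dE : d = ofR (modS d) by rewrite ofR_modS gtr0_norm.
  have {}d0 : 0 < modS d by rewrite -(lt_ofR k) rmorph0 -dE.
  exists (2 / modS d) => y; have [->|y0] := eqVneq y 0.
    by rewrite linear0 modS0 l2norm0 mulr0.
  have yp : 0 < l2norm y.
    by rewrite lt_def l2norm_ge0 andbT; apply: contra y0 => /eqP/l2norm_eq0 ->.
  (* The multiple [c y] has norm half the radius of a ball on which [phi] has
     modulus below 1. *)
  pose c := modS d / 2 / l2norm y.
  have cp : 0 < c by rewrite !divr_gt0.
  have mc : modS (ofR c) = c by rewrite modS_ofR gtr0_norm.
  have := phid (ofR c *: y); rewrite /= linearZ /= modSM mc => phic.
  have : c * modS (phi y) < 1.
    apply: phic; rewrite -ball_normE /= sub0r normrN ell2_normE dE lt_ofR l2normZ mc.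
    by rewrite /c divfK ?gt_eqF// ltr_pdivrMr// ltr_pMr// ltr1n.
  rewrite mulrC -ltr_pdivlMr// => /ltW/le_trans; apply.
  rewrite /c le_eqVlt; apply/orP; left; apply/eqP; field.
  by rewrite !gt_eqF.
have fl : linear (fun y => phi y *: unit_vec R k 0).
  by move=> a u v; rewrite linearD linearZ /= scalerDl scalerA.
have [|T TE] := bop_of_linear fl.
  by exists M => y; rewrite l2normZ l2norm_unit_vec mulr1.
exists (adjoint T (unit_vec R k 0)) => y.
rewrite -inner_adjoint TE innerZl inner_unit_vec /=.
by rewrite mulr1.
Qed.

Lemma inner_cdual w : exists phi : cdual R k, forall y, phi y = inner y w.
Proof.
have fl : scalar (fun y : H => inner y w).
  by move=> a u v; rewrite innerDl innerZl.
pose phi : {scalar H} := HB.pack (fun y => inner y w)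
  (GRing.isLinear.Build _ _ _ _ (fun y => inner y w) fl).
have phiE y : phi y = inner y w by [].
have cphi : continuous phi.
  move=> y; apply: (cvg_scalarsP _ _ (nbhs_filter y)).2 => e e0.
  have w0 : 0 < l2norm w + 1 by rewrite ltr_wpDl ?l2norm_ge0.
  have := (cvg_ell2P id y (nbhs_filter y)).1 (@cvg_id _ _) _ (divr_gt0 e0 w0).
  apply: filterS => z; rewrite ltr_pdivlMr// => ze.
  rewrite !phiE -innerBl; apply: (le_lt_trans (inner_le _ _)).
  by apply: le_lt_trans ze; rewrite ler_wpM2l ?l2norm_ge0 ?lerDl.
by exists (@CDual _ _ phi cphi).
Qed.

End Operators.

(** * The operator topologies in terms of real numbers *)

Section Convergence.
Local Open Scope ring_scope.
Context (R : realType) (k : scalar_kind).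
Local Notation H := (ell2 R k).
Local Notation B1 := (ball1 R k).
Implicit Types (T : B1) (F : set_system B1).

(** Arbitrary filters, rather than the neighbourhood filter alone, allow the
    image of a sequence or of a filter under the adjoint to be tested. *)
Lemma continuity_pointsP (S S' : topologicalType) (f : S -> S') (x : S) :
  continuity_points f x <->
  forall F : set_system S, Filter F -> F --> x -> f @ F --> f x.
Proof.
split=> [fx F FF Fx|fF]; last by apply: fF; exact: cvg_id.
exact: cvg_comp Fx fx.
Qed.

Lemma cvg_SOT_normP F T : Filter F -> F --> (T : SOT R k) <->
  forall (x : H) (e : R), 0 < e -> \forall S \near F, l2norm ((S : B1) x - T x) < e.
Proof.
move=> FF; rewrite cvg_SOTP.
by split=> FT x; apply/cvg_ell2P; exact: FT.
Qed.

Lemma cvg_SOTl_normP F T : Filter F -> F --> (T : SOTl R k) <->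
  forall (x : H) (e : R), 0 < e ->
    \forall S \near F, l2norm (adjoint (S : B1) x - adjoint T x) < e.
Proof.
move=> FF; rewrite cvg_SOTlP.
by split=> FT x; apply/cvg_ell2P; exact: FT.
Qed.

(** Weak convergence may be tested on inner products alone, since by
    [riesz_representation] they exhaust the continuous functionals. *)
Lemma cvg_WOT_innerP F T : Filter F -> F --> (T : WOT R k) <->
  forall (x w : H) (e : R), 0 < e ->
    \forall S \near F, modS (inner ((S : B1) x - T x) w) < e.
Proof.
move=> FF; rewrite cvg_WOTP; split=> FT x.
  move=> w e e0; have [phi phiE] := inner_cdual w.
  have := (cvg_scalarsP _ _ FF).1 (FT x phi) e e0.
  by apply: filterS => S; rewrite !phiE innerBl.
move=> phi; have [w phiE] := riesz_representation phi.
apply: (cvg_scalarsP _ _ FF).2 => e e0; apply: filterS (FT x w e e0) => S.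
by rewrite !phiE innerBl.
Qed.

Lemma cvg_SOT_WOT F T : Filter F -> F --> (T : SOT R k) -> F --> (T : WOT R k).
Proof.
move=> FF /cvg_SOT_normP FT; apply/cvg_WOT_innerP => x w e e0.
have w0 : 0 < l2norm w + 1 by rewrite ltr_wpDl ?l2norm_ge0.
apply: filterS (FT x (e / (l2norm w + 1)) (divr_gt0 e0 w0)) => S.
rewrite ltr_pdivlMr// => Se; apply: (le_lt_trans (inner_le _ _)).
by apply: le_lt_trans Se; rewrite ler_wpM2l ?l2norm_ge0 ?lerDl.
Qed.

Local Notation adj := (@ball1_adjoint R k).

Lemma cvg_adjoint_SOT F T : Filter F ->
  adj @ F --> (adj T : SOT R k) <-> F --> (T : SOTl R k).
Proof.
move=> FF; have FadjF : Filter (adj @ F) by exact: fmap_filter.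
have H1 := @cvg_SOT_normP (adj @ F) (adj T) FadjF.
have H2 := @cvg_SOTl_normP F T FF.

split=> [/H1 A1|/H2 A1].
  by apply: H2.2 => x e e0; have := A1 x e e0; rewrite near_map.
by apply: H1.2 => x e e0; rewrite near_map; exact: A1.
Qed.

Lemma cvg_adjoint_WOT F T : Filter F ->
  adj @ F --> (adj T : WOT R k) <-> F --> (T : WOT R k).
Proof.
move=> FF; have FadjF : Filter (adj @ F) by exact: fmap_filter.
have H1 := @cvg_WOT_innerP (adj @ F) (adj T) FadjF.
have H2 := @cvg_WOT_innerP F T FF.
have sym (S : B1) (x w : H) : modS (inner (S x - T x) w) =
    modS (inner (adjoint S w - adjoint T w) x).
  by rewrite innerBl 2!inner_adjoint -innerBr modS_innerC.
split=> [/H1 A1|/H2 A1].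
  apply: H2.2 => x w e e0.
  have := A1 w x e e0; rewrite near_map; apply: filterS => S.
  by rewrite sym.
apply: H1.2 => x w e e0; rewrite near_map; apply: filterS (A1 w x e e0) => S.
by rewrite sym.
Qed.

Lemma cvg_adjoint_SOTl F T : Filter F ->
  adj @ F --> (adj T : SOTl R k) <-> F --> (T : SOT R k).
Proof.
move=> FF; have FadjF : Filter (adj @ F) by exact: fmap_filter.
have H1 := @cvg_SOTl_normP (adj @ F) (adj T) FadjF.
have H2 := @cvg_SOT_normP F T FF.
split=> [/H1 A1|/H2 A1].
  apply: H2.2 => x e e0; have := A1 x e e0; rewrite near_map.
  by apply: filterS => S; rewrite !adjointK.
apply: H1.2 => x e e0; rewrite near_map; apply: filterS (A1 x e e0) => S.
by rewrite !adjointK.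
Qed.

Lemma cvg_SOTl_WOT F T : Filter F ->
  F --> (T : SOTl R k) -> F --> (T : WOT R k).
Proof.
move=> FF FT; apply: (cvg_adjoint_WOT _ FF).1.
by apply: cvg_SOT_WOT; exact: (cvg_adjoint_SOT _ FF).2.
Qed.

End Convergence.

(** * Perturbing a contraction along a coordinate direction *)

Section Perturbation.
Local Open Scope ring_scope.
Context (R : realType) (k : scalar_kind).
Local Notation H := (ell2 R k).
Local Notation B1 := (ball1 R k).
Local Notation ofR := (ofR R k).
Local Notation conjS := (conjS R k).
Local Notation e_ := (unit_vec R k).
Implicit Types (T : B1) (u v w x y : H).

Definition defect_vec T x : H := x - adjoint T (T x).

Lemma inner_defect_vec T x y :
  inner y (defect_vec T x) = inner y x - inner (T y) (T x).
Proof. by rewrite /defect_vec innerBr -inner_adjoint. Qed.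

Lemma inner_defect_vec_self T x :
  inner x (defect_vec T x) = ofR (l2norm x ^+ 2 - l2norm (T x) ^+ 2).
Proof. by rewrite inner_defect_vec !inner_norm rmorphB. Qed.

(** The Cauchy-Schwarz inequality of the form [B y x = <y, x> - <T y, T x>],
    which is positive because [T] is a contraction.  As [B x x <= 1] when
    [l2norm x <= 1], positivity at a single vector is enough. *)
Lemma defect_cauchy_schwarz T x y : l2norm x <= 1 ->
  modS (inner y (defect_vec T x)) ^+ 2 <= l2norm y ^+ 2 - l2norm (T y) ^+ 2.
Proof.
move=> x1; set a := inner y (defect_vec T x).
have aE : inner y x = a + inner (T y) (T x).
  by rewrite /a inner_defect_vec subrK.
have aE' : inner x y = conjS a + inner (T x) (T y).
  by rewrite inner_conj aE rmorphD -inner_conj.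
(* The positivity of the form at [z] reads
   [0 <= B y y - 2 |a|^2 + |a|^2 B x x], with [B x x <= 1]. *)
set z := y - a *: x.
have zE : l2norm z ^+ 2 - l2norm (T z) ^+ 2 =
    l2norm y ^+ 2 - l2norm (T y) ^+ 2 - 2 * modS a ^+ 2 +
    modS a ^+ 2 * (l2norm x ^+ 2 - l2norm (T x) ^+ 2).
  apply: (@ofR_inj R k).
  rewrite !(rmorphD, rmorphN, rmorphM ofR 2, rmorphM ofR (modS a ^+ 2)) /=.
  rewrite -!inner_norm.
  rewrite rmorph1 -mulr_conjS.
  have -> : T z = T y - a *: T x by rewrite linearB linearZ.
  rewrite !innerBl !innerBr.
  rewrite !innerZl !innerZr aE aE'.
  ring.
have z0 : 0 <= l2norm z ^+ 2 - l2norm (T z) ^+ 2.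
  by rewrite subr_ge0 lerXn2r ?nnegrE ?l2norm_ge0 ?ball1_contraction.
have : modS a ^+ 2 * (l2norm x ^+ 2 - l2norm (T x) ^+ 2) <= modS a ^+ 2.
  rewrite -[leRHS]mulr1 ler_wpM2l ?exprn_ge0 ?modS_ge0//.
  have := exprn_ge0 2 (l2norm_ge0 (T x)).
  by have := exprn_ile1 2 (l2norm_ge0 x) x1; lra.
by move: z0; rewrite zE; lra.
Qed.

(** The vector [S y] is [T y] with its [n]-th coordinate replaced by
    [<y, defect_vec T x>], so that the square of its norm is at most
    [l2norm (T y) ^+ 2] plus the square of the new coordinate, and
    [defect_cauchy_schwarz] bounds the latter. *)
Lemma perturbation_exists T x n : l2norm x <= 1 ->
  exists S : B1, forall y,
    S y = T y + inner y (defect_vec T x - adjoint T (e_ n)) *: e_ n.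
Proof.
move=> x1; apply: ball1_of_linear => [a u v|y].
  rewrite linearP innerDl innerZl scalerDl -scalerA scalerDr.
  by rewrite !addrA; congr (_ + _); rewrite -!addrA; congr (_ + _); rewrite addrC.
set q := T y - T y n *: e_ n.
have qe : inner q (e_ n) = 0.
  by rewrite innerBl innerZl !inner_unit_vec /= eqxx mulr1 subrr.
have pyth c : l2norm (q + c *: e_ n) ^+ 2 = l2norm q ^+ 2 + modS c ^+ 2.
  by rewrite pythagoras ?innerZr ?qe ?mulr0// l2normZ l2norm_unit_vec mulr1.
have -> : T y + inner y (defect_vec T x - adjoint T (e_ n)) *: e_ n =
    q + inner y (defect_vec T x) *: e_ n.
  by rewrite innerBr -inner_adjoint inner_unit_vec scalerBl addrA addrAC.
have : l2norm (T y) ^+ 2 = l2norm q ^+ 2 + modS (T y n) ^+ 2.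
  by rewrite -pyth subrK.
have := defect_cauchy_schwarz T y x1; have := sq_ge0 (T y) n.
move=> h1 h2 h3; rewrite -(@ler_pXn2r _ 2) ?nnegrE ?l2norm_ge0// pyth.
by move: h1 h2 h3; lra.
Qed.

Lemma adjoint_rank_one_perturbation (S T : B1) v n :
    (forall y, S y = T y + inner y v *: e_ n) ->
  forall w, adjoint S w = adjoint T w + w n *: v.
Proof.
move=> SE w; apply: inner_ext => z.
rewrite innerDl innerZl !inner_adjointl SE innerDr innerZr inner_unit_vec.
by rewrite -inner_conj mulrC.
Qed.

(** For [l2norm x <= 1], the perturbations of [perturbation_exists] along the
    [e_ n] tend to [T] in the lower-star topology, whereas their values at [x]
    lie at a distance from [T x] that tends to
    [l2norm x ^+ 2 - l2norm (T x) ^+ 2]; this difference must then vanish. *)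
Lemma isometry_of_cvg_SOTl_SOT T :
  (forall F : set_system B1, Filter F ->
    F --> (T : SOTl R k) -> F --> (T : SOT R k)) -> isometry_op T.
Proof.
move=> TP.
have iso1 x : l2norm x <= 1 -> l2norm (T x) = l2norm x.
  move=> x1; have [S SE] := choice (fun n => perturbation_exists T n x1).
  set v := fun n => defect_vec T x - adjoint T (e_ n).
  have vb n : l2norm (v n) <= l2norm (defect_vec T x) + 1.
    apply: (le_trans (l2normD _ _)); rewrite lerD2l l2normN.
    rewrite -(l2norm_unit_vec R k n); exact: (ball1_contraction (ball1_adjoint T)).
  have FS : Filter (S @ \oo) by exact: fmap_filter.
  have ST : S @ \oo --> (T : SOTl R k).
    apply: (cvg_SOTl_normP _ FS).2 => w e e0; rewrite near_map.
    have c0 : 0 < l2norm (defect_vec T x) + 1 by rewrite ltr_wpDl ?l2norm_ge0.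
    apply: filterS (coordinate_cvg0 w (divr_gt0 e0 c0)) => n.
    rewrite ltr_pdivlMr// => wne; rewrite (adjoint_rank_one_perturbation (SE n)).
    rewrite addrC addKr l2normZ; apply: le_lt_trans wne.
    by rewrite ler_wpM2l ?modS_ge0 ?vb.
  have {ST} := (cvg_SOT_normP _ FS).1 (TP _ FS ST) x => ST.
  have d0 : modS (inner x (defect_vec T x)) <= 0.
    apply/ler_addgt0Pr => e e0; rewrite add0r.
    have e20 : 0 < e / 2 by rewrite divr_gt0.
    have Sn := ST _ e20; rewrite near_map in Sn.
    have [n [Sne Tne]] := filter_ex (filterI Sn (coordinate_cvg0 (T x) e20)).
    move: Sne; rewrite SE addrC addKr l2normZ l2norm_unit_vec mulr1.
    rewrite innerBr -inner_adjoint inner_unit_vec => Sne.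
    rewrite -(subrK (T x n) (inner x _)); apply: (le_trans (modSD _ _)).
    by move: Sne Tne; lra.
  move: d0; rewrite inner_defect_vec_self modS_ofR normr_le0 subr_eq0.
  by rewrite eqrXn2 ?l2norm_ge0// => /eqP.
move=> x; rewrite !ell2_normE; congr (ofR _).
have [->|x0] := eqVneq x 0; first by rewrite linear0.
have xp : 0 < l2norm x.
  by rewrite lt_def l2norm_ge0 andbT; apply: contra x0 => /eqP/l2norm_eq0 ->.
have mx : modS (ofR (l2norm x)^-1) = (l2norm x)^-1.
  by rewrite modS_ofR ger0_norm// invr_ge0 ltW.
have := iso1 (ofR (l2norm x)^-1 *: x); rewrite linearZ !l2normZ mx.
rewrite mulVf ?gt_eqF// => /(_ (lexx _)) Tx.
by rewrite -[RHS]mulr1 -Tx mulVKf// gt_eqF.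
Qed.

(** For an isometry the increment [S x - T x] is controlled by its inner
    product with [T x], because [l2norm (S x) <= l2norm x = l2norm (T x)]. *)
Lemma isometry_cvg_WOT_SOT T (F : set_system B1) : Filter F ->
  isometry_op T -> F --> (T : WOT R k) -> F --> (T : SOT R k).
Proof.
move=> FF Tiso FT; apply: (cvg_SOT_normP _ FF).2 => x e e0.
have Tx : l2norm (T x) = l2norm x.
  by apply: (@ofR_inj R k); rewrite -!ell2_normE Tiso.
have e20 : 0 < e ^+ 2 / 2 by rewrite divr_gt0 ?exprn_gt0.
apply: filterS ((cvg_WOT_innerP _ FF).1 FT x (T x) _ e20) => S SdT.
rewrite -(@ltr_pXn2r _ 2) ?nnegrE ?l2norm_ge0 ?(ltW e0)//.
apply: (le_lt_trans (l2norm_sqr_increment (T x) _)).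
rewrite subrKC Tx.
have : l2norm (S x) ^+ 2 <= l2norm x ^+ 2.
  by rewrite lerXn2r ?nnegrE ?l2norm_ge0 ?ball1_contraction.
by move: SdT; lra.
Qed.

(** The increment [adjoint T (T x) - x] is orthogonal to [x] and the norm of
    [adjoint T (T x)] is at most that of [x]. *)
Lemma isometry_adjointK T : isometry_op T -> forall x, adjoint T (T x) = x.
Proof.
move=> Tiso x.
have Tx y : l2norm (T y) = l2norm y.
  by apply: (@ofR_inj R k); rewrite -!ell2_normE Tiso.
apply/eqP; rewrite -subr_eq0; apply/eqP/l2norm_eq0/eqP.
rewrite -sqrf_eq0 eq_le exprn_ge0 ?l2norm_ge0// andbT.
apply: (le_trans (l2norm_sqr_increment x _)).
rewrite innerBl inner_adjointl !inner_norm Tx subrr modS0 mulr0 addr0.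
rewrite subrKC subr_le0 lerXn2r ?nnegrE ?l2norm_ge0// -[leRHS]Tx.
exact: (ball1_contraction (ball1_adjoint T)).
Qed.

(** That [T] is an isometry makes the adjoint its left inverse, and that the
    adjoint is an isometry makes it a right inverse. *)
Lemma unitaryP T : unitary_op T <-> isometry_op T /\ coisometry_op T.
Proof.
split=> [[TT1 TT2]|[Tiso Tco]].
  have iso_of (S : B1) : (forall x, adjoint S (S x) = x) -> isometry_op S.
    move=> SS x; rewrite !ell2_normE; congr (ofR _); apply/eqP.
    rewrite -(@eqrXn2 _ 2) ?l2norm_ge0//; apply/eqP/(@ofR_inj R k).
    by rewrite -!inner_norm inner_adjoint SS.
  split; first exact: iso_of.
  by apply: (iso_of (ball1_adjoint T)) => x; rewrite /= adjointK TT2.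
split; first exact: isometry_adjointK.
move=> x; have := isometry_adjointK (T := ball1_adjoint T) Tco x.
by rewrite /= adjointK.
Qed.

End Perturbation.

(** * Duality and the continuity points *)

Section Duality.
Local Open Scope ring_scope.
Context (R : realType) (k : scalar_kind).
Local Notation H := (ell2 R k).
Local Notation B1 := (ball1 R k).
Local Notation adj := (@ball1_adjoint R k).
Implicit Types (T : B1) (F : set_system B1).

(** Operators with the same values are equal, and not only indistinguishable by
    the topologies; this makes the adjoint a genuine involution. *)
Lemma ball1_ext (S T : B1) : (forall x, S x = T x) -> S = T.
Proof.
case: S T => [[S bS] nS] [[T bT] nT] /= ST.
have {}ST : S = T.
  case: S T {bS nS bT nT} ST => [S [[cS] [dS]]] [T [[cT] [dT]]] /= /funext ST.
  by subst T; rewrite (Prop_irrelevance cS cT) (Prop_irrelevance dS dT).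
subst T; rewrite (Prop_irrelevance bS bT) in nS *.
by rewrite (Prop_irrelevance nS nT).
Qed.

Lemma ball1_adjointK : involutive adj.
Proof. by move=> T; apply: ball1_ext => x /=; rewrite adjointK. Qed.

Lemma coisometry_of_cvg_SOT_SOTl T :
  (forall F, Filter F -> F --> (T : SOT R k) -> F --> (T : SOTl R k)) ->
  coisometry_op T.
Proof.
move=> TP; apply: (@isometry_of_cvg_SOTl_SOT _ _ (adj T)) => F FF.
have FadjF : Filter (adj @ F) by exact: fmap_filter.
move=> /(cvg_adjoint_SOT (adj T) FF).2; rewrite ball1_adjointK => FT.
apply: (cvg_adjoint_SOTl (adj T) FF).1; rewrite ball1_adjointK.
exact: TP FT.
Qed.

Lemma coisometry_cvg_WOT_SOTl T F : Filter F ->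
  coisometry_op T -> F --> (T : WOT R k) -> F --> (T : SOTl R k).
Proof.
move=> FF Tco FT; have FadjF : Filter (adj @ F) by exact: fmap_filter.
apply: (cvg_adjoint_SOT T FF).1.
apply: (@isometry_cvg_WOT_SOT _ _ (adj T) _ FadjF Tco).
exact: (cvg_adjoint_WOT T FF).2.
Qed.

End Duality.

Theorem proposition2p11 (R : realType) (k : scalar_kind) :
  [/\ continuity_points (id : WOT R k -> SOT R k) =
        [set T : ball1 R k | isometry_op T],
      continuity_points (id : WOT R k -> SOTu R k) =
        [set T : ball1 R k | unitary_op T],
      continuity_points (id : WOT R k -> SOTl R k) =
        [set T : ball1 R k | coisometry_op T],
      continuity_points (id : SOT R k -> SOTu R k) =
        [set T : ball1 R k | coisometry_op T]
    & continuity_points (id : SOTl R k -> SOTu R k) =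
        [set T : ball1 R k | isometry_op T] ].
Proof.
split; apply/seteqP; split=> T /=.
- move=> /continuity_pointsP TP; apply: isometry_of_cvg_SOTl_SOT => F FF FT.
  by apply: TP; exact: cvg_SOTl_WOT.
- move=> Tiso; apply/continuity_pointsP => F FF FT.
  exact: isometry_cvg_WOT_SOT.
- move=> /continuity_pointsP TP; apply/unitaryP; split.
    apply: isometry_of_cvg_SOTl_SOT => F FF FT.
    by have /(cvg_SOTuP _ FF)[] := TP F FF (cvg_SOTl_WOT FF FT).
  apply: coisometry_of_cvg_SOT_SOTl => F FF FT.
  by have /(cvg_SOTuP _ FF)[] := TP F FF (cvg_SOT_WOT FF FT).
- move=> /unitaryP[Tiso Tco]; apply/continuity_pointsP => F FF FT.
  apply: (cvg_SOTuP _ FF).2.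
  by split; [exact: isometry_cvg_WOT_SOT|exact: coisometry_cvg_WOT_SOTl].
- move=> /continuity_pointsP TP; apply: coisometry_of_cvg_SOT_SOTl => F FF FT.
  by apply: TP; exact: cvg_SOT_WOT.
- move=> Tco; apply/continuity_pointsP => F FF FT.
  exact: coisometry_cvg_WOT_SOTl.
- move=> /continuity_pointsP TP; apply: coisometry_of_cvg_SOT_SOTl => F FF FT.
  by have /(cvg_SOTuP _ FF)[] := TP F FF FT.
- move=> Tco; apply/continuity_pointsP => F FF FT; apply: (cvg_SOTuP _ FF).2.
  split; first exact: FT.
  by apply: coisometry_cvg_WOT_SOTl => //; exact: cvg_SOT_WOT.
- move=> /continuity_pointsP TP; apply: isometry_of_cvg_SOTl_SOT => F FF FT.
  by have /(cvg_SOTuP _ FF)[] := TP F FF FT.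
- move=> Tiso; apply/continuity_pointsP => F FF FT; apply: (cvg_SOTuP _ FF).2.
  split; last exact: FT.
  by apply: isometry_cvg_WOT_SOT => //; exact: cvg_SOTl_WOT.
Qed.
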